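(* Let $\mathbf{A}$ be a real $n\times n$ matrix that is strictly totally $J$-sign-symmetric (STJS). Then all eigenvalues of $\mathbf{A}$ are positive and simple: $$\rho(\mathbf{A})=\lambda_1>\lambda_2>\cdots>\lambda_n>0.$$
   Context: For $J\subseteq[m]=\{1,\ldots,m\}$ with $J^c=[m]\setminus J$, an $m\times m$ matrix $(a_{ik})$ is strictly $J$-sign-symmetric if $a_{ik}>0$ for $(i,k)\in(J\times J)\cup(J^c\times J^c)$ and $a_{ik}<0$ for $(i,k)\in(J\times J^c)\cup(J^c\times J)$; it is strictly sign-symmetric in this sense if it is strictly $J$-sign-symmetric for some $J$. The $j$th compound matrix $\mathbf{A}^{(j)}$ is the $\binom{n}{j}\times\binom{n}{j}$ matrix of all $j\times j$ minors of $\mathbf{A}$ with row and column index sets listed in lexicographic order. $\mathbf{A}$ is STJS if $\mathbf{A}$ is strictly $J$-sign-symmetric for some $J\subseteq[n]$ and, for every $j=2,\ldots,n$, $\mathbf{A}^{(j)}$ is strictly $J_j$-sign-symmetric for some subset $J_j$ of its index set. *)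

(* Defs.v *)
From HB Require Import structures.
From mathcomp Require Import all_boot all_order all_algebra.
From mathcomp Require Import reals.
Set Implicit Arguments. Unset Strict Implicit. Unset Printing Implicit Defensive.
Import Order.TTheory GRing.Theory Num.Theory.
Local Open Scope ring_scope.

Definition strictly_J_sign_symmetric (R : numDomainType) (I : finType)
  (a : I -> I -> R) (J : {set I}) : Prop :=
  forall i k : I, if (i \in J) == (k \in J) then 0 < a i k else a i k < 0.

Definition strictly_sign_symmetric (R : numDomainType) (I : finType)
  (a : I -> I -> R) : Prop :=
  exists J : {set I}, strictly_J_sign_symmetric a J.

Definition jsubset (n j : nat) := {S : {set 'I_n} | #|S| == j}.

(* The increasing enumeration 'I_j -> 'I_n of a j-subset
   (enum of a set of ordinals is increasing). *)
Definition jsubset_enum (n j : nat) (S : jsubset n j) : 'I_j -> 'I_n :=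
  fun i => @enum_val _ (mem (val S)) (cast_ord (esym (eqP (valP S))) i).

Definition minor (R : comNzRingType) (n j : nat) (A : 'M[R]_n)
  (S T : jsubset n j) : R :=
  \det (\matrix_(a < j, b < j) A (jsubset_enum S a) (jsubset_enum T b)).

Definition compound (R : comNzRingType) (n j : nat) (A : 'M[R]_n) :
  jsubset n j -> jsubset n j -> R := fun S T => minor A S T.

Definition STJS (R : numDomainType) (n : nat) (A : 'M[R]_n) : Prop :=
  strictly_sign_symmetric (fun i k : 'I_n => A i k) /\
  forall j : nat, (2 <= j <= n)%N -> strictly_sign_symmetric (@compound R n j A).

(* Main.v *)
(* Perron's theorem applies to every compound A^(j), because conjugation by a
   diagonal matrix of signs makes it positive: A^(j) has a simple positive
   eigenvalue that strictly dominates the modulus of all the others.  By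
   Cauchy-Binet, a triangular form of A over the complex numbers induces one of
   A^(j), so the eigenvalues of A^(j) are the products of j eigenvalues of A.
   When |lam_1| >= ... >= |lam_n|, exchanging one factor shows that the dominant
   product is lam_1 ... lam_j; it is positive and strictly larger in modulus
   than lam_1 ... lam_(j-1) lam_(j+1), for every j. *)

Require Import Defs.
From HB Require Import structures.
From mathcomp Require Import all_boot all_order all_algebra.
From mathcomp Require Import reals.
From mathcomp Require Import all_fingroup polyrcf complex.
Set Implicit Arguments. Unset Strict Implicit. Unset Printing Implicit Defensive.
Import Order.TTheory GRing.Theory Num.Theory.
Local Open Scope ring_scope.

(** * Adjugate and determinant after deleting one row and column *)

Section DeletedRowColumn.
Variables (D : idomainType) (n : nat) (M : 'M[D]_n.+1) (k : 'I_n.+1).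
Let Mk := row' k (col' k M).

Lemma adj_diag : (\adj M) k k = \det Mk.
Proof. by rewrite mxE /cofactor -signr_odd oddD addbb mul1r. Qed.

(** Let [y] and [b] be the [k]-th columns of [\adj M] and [M] without their [k]-th entries. The rows
    other than [k] of [M *m \adj M = (\det M)%:M] read [Mk *m y = - (\det Mk *: b)]; multiply by
    [\adj Mk] and cancel [\det Mk]. *)
Lemma adj_offdiag i : \det Mk != 0 ->
  (\adj M) (lift k i) k = - \sum_l (\adj Mk) i l * M (lift k l) k.
Proof.
move=> Mk0; pose y : 'cV[D]_n := \col_q (\adj M) (lift k q) k.
pose b : 'cV[D]_n := \col_l M (lift k l) k.
have eqy : Mk *m y = - (\det Mk *: b).
  apply/matrixP => l j; rewrite !mxE.
  have := congr1 (fun N : 'M_n.+1 => N (lift k l) k) (mul_mx_adj M).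
  rewrite !mxE eq_sym (negPf (neq_lift k l)) mulr0n (bigD1_ord k) //= adj_diag.
  move/eqP; rewrite addrC addr_eq0 => /eqP.
  rewrite mulrC => <-; apply: eq_bigr => q _; rewrite !mxE //.
have: \adj Mk *m (Mk *m y) = \det Mk *: - (\adj Mk *m b).
  by rewrite eqy mulmxN -scalemxAr scalerN.
rewrite mulmxA mul_adj_mx mul_scalar_mx => /matrixP /(_ i ord0).
rewrite !mxE => /(mulfI Mk0) ->; congr (- _).
by apply: eq_bigr => l _; rewrite !mxE.
Qed.

Lemma det_deleted : \det Mk != 0 ->
  \det M = M k k * \det Mk
    - \sum_q \sum_l M k (lift k q) * (\adj Mk) q l * M (lift k l) k.
Proof.
move=> Mk0; have := congr1 (fun N : 'M_n.+1 => N k k) (mul_mx_adj M).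
rewrite !mxE eqxx mulr1n => <-; rewrite (bigD1_ord k) //= adj_diag.
congr (_ + _); rewrite -sumrN; apply: eq_bigr => q _.
rewrite adj_offdiag // mulrN mulr_sumr; congr (- _).
by apply: eq_bigr => l _; rewrite mulrA.
Qed.

End DeletedRowColumn.

Lemma char_poly_mx_deleted (R : nzRingType) n (B : 'M[R]_n.+1) k :
  row' k (col' k (char_poly_mx B)) = char_poly_mx (row' k (col' k B)).
Proof.
by apply/matrixP => i j; rewrite !mxE (inj_eq (@lift_inj _ k)).
Qed.

(** * Perron's theorem for positive matrices *)

Section PositiveMatrix.
Variable R : rcfType.

(** Beyond its last root a monic polynomial has its sign at infinity, which is positive; a negative
    value at [a] therefore forces a root above [a]. *)
Lemma max_root_above (p : {poly R}) a : p \is monic -> p.[a] < 0 ->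
  exists r, [/\ p.[r] = 0, (forall t, p.[t] <= 0 -> t <= r)
    & forall t, r < t -> 0 < p.[t]].
Proof.
move=> pm pa; have p0 := monic_neq0 pm.
have beyond x : {in `[x, +oo[, forall y, ~~ root p y} -> 0 < p.[x].
  move=> nr; have xx : x \in `[x, +oo[ by rewrite in_itv /= lexx.
  rewrite -sgr_cp0 (sgp_pinftyP nr xx) /sgp_pinfty (monicP pm) sgr1 //.
have rootsE x : (x \in rootsR p) = root p x.
  by rewrite -(roots_on_rootsR p0) in_itv.
(* The maximum starts from [a], so [r] is a root or [a] itself; in the latter case no root lies from
   [a] on, and [p.[a]] would be positive. *)
pose r := \big[Order.max/a]_(x <- rootsR p) x.
have le_r x : root p x -> x <= r.
  by rewrite -rootsE => xr; apply: (le_bigmax_seq _ x).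
have gt_r t : r < t -> 0 < p.[t].
  move=> rt; apply: beyond => y; rewrite in_itv /= andbT => ty.
  by apply/negP => /le_r; rewrite leNgt (lt_le_trans rt ty).
have [ra|nra] := boolP (r \in rootsR p).
  exists r; split=> //; first by apply/eqP; rewrite -rootE -rootsE.
  by move=> t; rewrite leNgt => /negP pt; rewrite leNgt; apply/negP => /gt_r.
have ra : r = a.
  move: nra; rewrite /r; elim: (rootsR p) => [|x s IH]; first by rewrite big_nil.
  rewrite big_cons in_cons negb_or => /andP[].
  case: (leP x (\big[Order.max/a]_(j <- s) j)) => _; first by [].
  by rewrite eqxx.
have : 0 < p.[a].
  apply: beyond => y; rewrite in_itv /= andbT le_eqVlt => /predU1P[<-|].
    by rewrite rootE lt_eqF.
  by rewrite -ra; apply: contraTN => /le_r; rewrite leNgt.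
by rewrite ltNge ltW.
Qed.

(* Induction on the size: the largest root of the characteristic polynomial of
   each principal submatrix obtained by deleting one index lies strictly below
   that of [B]. *)
Lemma resolvent_gt0 n (B : 'M[R]_n.+1) : (forall i k, 0 < B i k) ->
  exists r, [/\ (char_poly B).[r] = 0,
    (forall t i k, r <= t -> 0 < ((\adj (char_poly_mx B)) i k).[t])
    & forall t, r < t -> 0 < (char_poly B).[t]].
Proof.
elim: n B => [|n IH] B Bpos.
  have cB : char_poly B = 'X - (B 0 0)%:P.
    by rewrite /char_poly det_mx11 !mxE mulr1n.
  exists (B 0 0); rewrite cB; split=> [|t i k _|t].
  - by rewrite !hornerE subrr.
  - rewrite (ord1 i) (ord1 k) mxE /cofactor det_mx00 addn0 expr0 mulr1.
    by rewrite hornerE ltr01.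
  - by rewrite !hornerE subr_gt0.
pose Bk k := row' k (col' k B).
have /fin_all_exists [rk rkP] : forall k, exists r, [/\ (char_poly (Bk k)).[r] = 0,
    (forall t i l, r <= t -> 0 < ((\adj (char_poly_mx (Bk k))) i l).[t])
    & forall t, r < t -> 0 < (char_poly (Bk k)).[t]].
  by move=> k; apply: IH => i l; rewrite !mxE.
have det0 k : \det (row' k (col' k (char_poly_mx B))) != 0.
  by rewrite char_poly_mx_deleted; apply: monic_neq0; apply: char_poly_monic.
have offd i k : i != k -> char_poly_mx B i k = - (B i k)%:P.
  by move=> ik; rewrite !mxE (negPf ik) mulr0n sub0r.
(* At [rk k] the leading term of [det_deleted] vanishes. What remains is minus a sum of positive
   terms, since the signs of the two off-diagonal factors cancel. *)
have neg k : (char_poly B).[rk k] < 0.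
  have [rk0 rkadj _] := rkP k.
  rewrite /char_poly (det_deleted (det0 k)) char_poly_mx_deleted hornerD hornerM.
  rewrite -[\det _]/(char_poly (Bk k)) rk0 mulr0 add0r hornerN oppr_lt0.
  rewrite horner_sum (bigD1 ord0) //= ltr_pwDl //.
    rewrite horner_sum (bigD1 ord0) //= ltr_pwDl //.
      rewrite !offd ?neq_lift 1?eq_sym ?neq_lift // !hornerE mulrAC mulrNN.
      by rewrite !pmulr_rgt0 ?Bpos // rkadj.
    apply: sumr_ge0 => l _; rewrite !offd ?neq_lift 1?eq_sym ?neq_lift // !hornerE.
    by rewrite mulrAC mulrNN ltW // !pmulr_rgt0 ?Bpos // rkadj.
  apply: sumr_ge0 => q _; rewrite horner_sum; apply: sumr_ge0 => l _.
  rewrite !offd ?neq_lift 1?eq_sym ?neq_lift // !hornerE.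
  by rewrite mulrAC mulrNN ltW // !pmulr_rgt0 ?Bpos // rkadj.
have [r [pr le_r gt_r]] := max_root_above (char_poly_monic B) (neg ord0).
have rkr k : rk k < r.
  rewrite lt_neqAle le_r ?ltW // andbT; apply: contraTneq (neg k) => ->.
  by rewrite pr ltxx.
exists r; split=> // t i k rt.
have [_ rkadj rkdet] := rkP k.
(* Off the diagonal, [adj_offdiag] gives a sum of entries of [B] times adjugate entries of the
   smaller matrix, positive since [t > rk k]; on the diagonal the entry is [char_poly (Bk k)]. *)
case: (unliftP k i) => [i' ->|->].
  rewrite adj_offdiag // char_poly_mx_deleted -sumrN horner_sum.
  rewrite (bigD1 ord0) //= ltr_pwDl //.
    rewrite offd 1?eq_sym ?neq_lift // -mulrN opprK !hornerE pmulr_rgt0 ?Bpos //.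
    by rewrite rkadj // ltW // (lt_le_trans (rkr k)).
  apply: sumr_ge0 => l _.
  rewrite offd 1?eq_sym ?neq_lift // -mulrN opprK !hornerE ltW // pmulr_rgt0 ?Bpos //.
  by rewrite rkadj // ltW // (lt_le_trans (rkr k)).
by rewrite adj_diag char_poly_mx_deleted rkdet // (lt_le_trans (rkr k)).
Qed.

(** As [char_poly B] vanishes at [r], the matrix [r%:M - B] kills the columns of its own adjugate,
    and these are positive by [resolvent_gt0]. *)
Lemma perron_root n (B : 'M[R]_n.+1) : (forall i k, 0 < B i k) ->
  exists r, exists v : 'cV[R]_n.+1, [/\ 0 < r, (char_poly B).[r] = 0,
    (char_poly B)^`().[r] != 0, (forall i, 0 < v i 0) & B *m v = r *: v].
Proof.
move=> Bpos; have [r [pr adjr _]] := resolvent_gt0 Bpos.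
pose Q := \adj (char_poly_mx B).
have MQ i k : \sum_l char_poly_mx B i l * Q l k = (char_poly B *+ (i == k)).
  by have /matrixP/(_ i k) := mul_mx_adj (char_poly_mx B); rewrite !mxE.
have QM i k : \sum_l Q i l * char_poly_mx B l k = (char_poly B *+ (i == k)).
  by have /matrixP/(_ i k) := mul_adj_mx (char_poly_mx B); rewrite !mxE.
have hM i k : (char_poly_mx B i k).[r] = r *+ (i == k) - B i k.
  by rewrite !mxE hornerD hornerN hornerMn hornerX hornerC.
have dM i k : (char_poly_mx B i k)^`() = (i == k)%:R.
  by rewrite !mxE derivB derivC subr0 derivMn derivX.
have Qpos i k : 0 < (Q i k).[r] by apply: adjr.
pose v : 'cV[R]_n.+1 := \col_i (Q i 0).[r].
have Bv : B *m v = r *: v.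
  apply/matrixP => i j; rewrite (ord1 j) mxE [RHS]mxE [v i 0]mxE.
  have /(congr1 (fun p => p.[r])) := MQ i 0.
  rewrite hornerMn pr mul0rn horner_sum.
  under eq_bigr do rewrite hornerM hM mulrBl.
  rewrite sumrB (bigD1 i) //= eqxx mulr1n big1 ?addr0; last first.
    by move=> l; rewrite eq_sym => /negPf ->; rewrite mulr0n mul0r.
  by move/eqP; rewrite subr_eq0 => /eqP ->; apply: eq_bigr => l _; rewrite mxE.
have vpos i : 0 < v i 0 by rewrite mxE.
exists r, v; split=> //.
  have := congr1 (fun N : 'cV_n.+1 => N 0 0) Bv; rewrite mxE [RHS]mxE => rv.
  rewrite -(pmulr_lgt0 _ (vpos 0)) -rv (bigD1 ord0) //= ltr_pwDl //.
    by rewrite pmulr_rgt0.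
  by apply: sumr_ge0 => l _; rewrite ltW // pmulr_rgt0.
(* Differentiating [M Q = p I] and multiplying by the left null row [u] of
   [M(r)] gives [u Q(r) = p'(r) u]. *)
apply/eqP => dp0.
have : \sum_i (Q 0 i).[r] * (Q i 0).[r] = 0.
  have eqQ i : (Q i 0).[r] = - \sum_l (char_poly_mx B i l).[r] * (Q l 0)^`().[r].
    have /(congr1 (fun p => p^`().[r])) := MQ i 0.
    rewrite derivMn hornerMn dp0 mul0rn -[_^`()]/(deriv _) raddf_sum horner_sum /=.
    under eq_bigr do rewrite derivM dM hornerD !hornerM.
    rewrite big_split /= (bigD1 i) //= eqxx hornerC mul1r big1 ?addr0.
      by move/eqP; rewrite addr_eq0 => /eqP.
    by move=> l; rewrite eq_sym => /negPf ->; rewrite horner0 mul0r.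
  under eq_bigr => i _ do rewrite [X in _ * X]eqQ mulrN mulr_sumr.
  rewrite sumrN exchange_big /= big1 ?oppr0 // => l _.
  under eq_bigr do rewrite mulrA -hornerM.
  by rewrite -mulr_suml -horner_sum QM hornerMn pr mul0rn mul0r.
apply/eqP; rewrite gt_eqF // (bigD1 ord0) //= ltr_pwDl //.
  by rewrite pmulr_rgt0.
by apply: sumr_ge0 => l _; rewrite ltW // pmulr_rgt0.
Qed.

End PositiveMatrix.

(** Take a left eigenvector [z] for [mu]. The defects [d k] of the triangle inequality in [z *m B],
    weighted by [v], add up to (r - |mu|) w. If |mu| >= r they all vanish, and the equality case
    forces [mu = r]. *)
Lemma perron_dominance (C : numClosedFieldType) n (B : 'M[C]_n.+1)
    (v : 'cV[C]_n.+1) r mu :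
  (forall i k, 0 < B i k) -> 0 < r -> (forall i, 0 < v i 0) -> B *m v = r *: v ->
  root (char_poly B) mu -> mu != r -> `|mu| < r.
Proof.
move=> Bpos r0 vpos Bv; rewrite -eigenvalue_root_char => /eigenvalueP[z zB z0].
apply: contraNT; rewrite -real_leNgt ?normr_real ?gtr0_real // => rmu.
have zBk k : \sum_i z 0 i * B i k = mu * z 0 k.
  by have /matrixP/(_ 0 k) := zB; rewrite !mxE.
have Bvi i : \sum_k B i k * v k 0 = r * v i 0.
  by have /matrixP/(_ i 0) := Bv; rewrite !mxE.
pose w := \sum_i `|z 0 i| * v i 0.
have wpos : 0 < w.
  have [i zi] : exists i, z 0 i != 0 by apply/rV0Pn.
  rewrite /w (bigD1 i) //= ltr_pwDl ?pmulr_rgt0 ?normr_gt0 //.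
  by apply: sumr_ge0 => l _; rewrite mulr_ge0 // ltW.
pose d k := \sum_i `|z 0 i * B i k| - `|\sum_i z 0 i * B i k|.
have d0 k : 0 <= d k by rewrite subr_ge0 ler_norm_sum.
have absB i k : `|z 0 i * B i k| = `|z 0 i| * B i k.
  by rewrite normrM (gtr0_norm (Bpos i k)).
have sB : \sum_k (\sum_i `|z 0 i| * B i k) * v k 0 = r * w.
  under eq_bigr do rewrite mulr_suml.
  rewrite exchange_big /= mulr_sumr; apply: eq_bigr => i _.
  under eq_bigr do rewrite -mulrA.
  by rewrite -mulr_sumr Bvi mulrCA.
have sd : \sum_k d k * v k 0 = (r - `|mu|) * w.
  under eq_bigr => k _.
    rewrite /d mulrBl zBk normrM; under eq_bigr do rewrite absB.
    rewrite -mulrA; over.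
  by rewrite sumrB sB -mulr_sumr mulrBl.
have dv0 : \sum_k d k * v k 0 == 0.
  rewrite eq_le sumr_ge0 ?andbT => [|k _]; last by rewrite mulr_ge0 // ltW.
  by rewrite sd pmulr_lle0 // subr_le0.
have : d 0 = 0.
  move: dv0; rewrite psumr_eq0 => [|k _]; last by rewrite mulr_ge0 // ltW.
  move/allP/(_ 0); rewrite mem_index_enum => /(_ isT) /= /eqP/eqP.
  by rewrite mulf_eq0 (gt_eqF (vpos 0)) orbF => /eqP.
(* Equality in column [0] already gives all [z 0 i] one phase [t], because each [B i 0] is positive.
   Then |z| is a left eigenvector for [mu], and pairing it with [v] gives [mu = r]. *)
move/eqP; rewrite subr_eq0 eq_sym => /eqP /normC_sum_eq [t t1 zt].
have {}zt i : z 0 i = `|z 0 i| * t.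
  have := zt i isT; rewrite absB mulrAC => /mulIf; apply.
  by rewrite gt_eqF.
have t0 : t != 0 by rewrite -normr_eq0 (eqP t1) oner_eq0.
have absBk k : \sum_i `|z 0 i| * B i k = mu * `|z 0 k|.
  apply: (mulIf t0); rewrite mulr_suml -mulrA -zt -zBk.
  by apply: eq_bigr => i _; rewrite [in RHS]zt mulrAC.
move/eqP: sB; under eq_bigr do rewrite absBk -mulrA.
by rewrite -mulr_sumr (inj_eq (mulIf (lt0r_neq0 wpos))).
Qed.

(** * Enumeration of subsets of fixed size *)

Section JsubsetEnum.
Variables n j : nat.
Implicit Types S U : jsubset n j.

Lemma jsubset_enum_inj S : injective (jsubset_enum S).
Proof. by move=> a b /enum_val_inj /cast_ord_inj. Qed.

Lemma jsubset_enumP S a : jsubset_enum S a \in val S.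
Proof. exact: enum_valP. Qed.

Lemma big_jsubset (R : Type) (idx : R) (op : Monoid.com_law idx)
    S (F : 'I_n -> R) :
  \big[op/idx]_(x in val S) F x = \big[op/idx]_a F (jsubset_enum S a).
Proof.
rewrite big_enum_val /= (reindex (cast_ord (esym (eqP (valP S))))) //=.
by apply: onW_bij; exists (cast_ord (eqP (valP S))) => a; apply: val_inj.
Qed.

Lemma jsubset_enum_onto S x : x \in val S -> exists a, jsubset_enum S a = x.
Proof.
move=> xS; exists (cast_ord (eqP (valP S)) (enum_rank_in xS x)).
by rewrite /jsubset_enum cast_ord_comp cast_ord_id enum_rankK_in.
Qed.

Lemma jsubset_sub_eq S U : val S \subset val U -> S = U.
Proof.
move=> sSU; apply/val_inj/eqP; rewrite eqEcard sSU.
by rewrite (eqP (valP S)) (eqP (valP U)) leqnn.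
Qed.

End JsubsetEnum.

(* [M] is triangular up to a reordering of the indices by weight. *)
Lemma det_weighted (R : comNzRingType) m (M : 'M[R]_m) (w : 'I_m -> nat) :
  (forall i k, i != k -> (w i <= w k)%N -> M i k = 0) ->
  \det M = \prod_i M i i.
Proof.
move=> wM; rewrite /determinant (bigD1 1%g) //= odd_perm1 mul1r [X in _ + X]big1 ?addr0.
  by apply: eq_bigr => i _; rewrite perm1.
(* If every moved index strictly lost weight, the total weight would drop, but a permutation
   preserves it. *)
move=> s s1; have [i /andP[si ws]] : exists i, (i != s i) && (w i <= w (s i))%N.
  apply/existsP; apply: contraNT s1 => /existsPn ws; apply/eqP/permP => i.
  rewrite perm1; apply/eqP; apply/negPn/negP => si.
  have : (\sum_i w (s i) < \sum_i w i)%N.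
    rewrite (bigD1 i) // [X in (_ < X)%N](bigD1 i) //= -addSn leq_add //.
      by have := ws i; rewrite eq_sym si /= -ltnNge.
    apply: leq_sum => k _; have := ws k.
    by have [<-|] := eqVneq k (s k) => //= _; rewrite -ltnNge => /ltnW.
  by rewrite [X in (_ < X)%N](reindex_inj (@perm_inj _ s)) ltnn.
by rewrite (bigD1 i) //= wM // mul0r mulr0.
Qed.

(** * Cauchy-Binet and compounds of triangular matrices *)

Section CauchyBinet.
Variable R : comNzRingType.

(** Multilinearity in the rows: [f] chooses, for each row of [X *m Y], the row of [Y] that it
    takes. *)
Lemma det_mulmx_expand j n (X : 'M[R]_(j, n)) (Y : 'M[R]_(n, j)) :
  \det (X *m Y) = \sum_(f : {ffun 'I_j -> 'I_n})
    (\prod_a X a (f a)) * \det (\matrix_(a, b) Y (f a) b).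
Proof.
under eq_bigr do rewrite mulr_sumr.
rewrite exchange_big /=; apply: eq_bigr => s _.
under eq_bigr do rewrite mxE.
rewrite bigA_distr_bigA mulr_sumr; apply: eq_bigr => f _.
rewrite big_split /= mulrCA; congr (_ * (_ * _)).
by apply: eq_bigr => a _; rewrite mxE.
Qed.

(** The Cauchy-Binet formula. In the expansion over [f], a repeated value gives two equal rows and
    contributes zero; the injective [f] are grouped by their image. *)
Lemma compoundM n j (A B : 'M[R]_n) (S U : jsubset n j) :
  compound (A *m B) S U = \sum_W compound A S W * compound B W U.
Proof.
pose X : 'M[R]_(j, n) := \matrix_(a, p) A (jsubset_enum S a) p.
pose Y : 'M[R]_(n, j) := \matrix_(p, b) B p (jsubset_enum U b).
have -> : compound (A *m B) S U = \det (X *m Y).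
  congr (\det _); apply/matrixP => a b; rewrite !mxE.
  by apply: eq_bigr => p _; rewrite !mxE.
rewrite det_mulmx_expand.
pose G (f : {ffun 'I_j -> 'I_n}) :=
  (\prod_a X a (f a)) * \det (\matrix_(a, b) Y (f a) b).
(* An injective [f] is its image [W] together with an ordering of [W]; the sign of that ordering
   completes the Leibniz sum of the minor of [A]. *)
pose h (p : jsubset n j * 'S_j) : {ffun 'I_j -> 'I_n} :=
  [ffun a => jsubset_enum p.1 (p.2 a)].
have h_inj : injective h.
  move=> [W s] [W' s'] /ffunP hh.
  have {}hh a : jsubset_enum W (s a) = jsubset_enum W' (s' a).
    by have := hh a; rewrite !ffunE.
  have eqW : W = W'.
    apply: jsubset_sub_eq; apply/subsetP => x /jsubset_enum_onto [a <-].
    by rewrite -(permKV s a) hh jsubset_enumP.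
  rewrite eqW in hh *; congr (_, _); apply/permP => a.
  exact: jsubset_enum_inj (hh a).
transitivity (\sum_(f in h @: setT) G f).
  rewrite [RHS]big_mkcond; apply: eq_bigr => f _.
  case: ifP => // /negbT nf; rewrite /G.
  have [/injectiveP finj|] := boolP (injectiveb f); last first.
    case/injectivePn => a [b ab fab].
    rewrite (determinant_alternate ab) ?mulr0 // => k.
    by rewrite !mxE fab.
  have cW : #|[set f a | a : 'I_j]| == j by rewrite card_imset // card_ord.
  pose W : jsubset n j := Sub [set f a | a : 'I_j] cW.
  have /fin_all_exists [s sP] : forall a, exists b, jsubset_enum W b = f a.
    by move=> a; apply: jsubset_enum_onto; apply: imset_f.
  have s_inj : injective s by move=> a b sab; apply: finj; rewrite -!sP sab.
  case/negP: nf; apply/imsetP; exists (W, perm s_inj); rewrite ?inE //.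
  by apply/ffunP => a; rewrite ffunE permE sP.
rewrite big_imset /=; last by move=> ? ? _ _; apply: h_inj.
rewrite (eq_bigl xpredT) => [|p]; last by rewrite inE.
rewrite -(pair_bigA _ (fun W s => G (h (W, s)))) /=.
apply: eq_bigr => W _; rewrite mulr_suml; apply: eq_bigr => s _.
rewrite /G mulrC [RHS]mulrAC; congr (_ * _); last first.
  by apply: eq_bigr => a _; rewrite !mxE ffunE.
rewrite -det_perm -det_mulmx -row_permE; congr (\det _).
by apply/matrixP => a b; rewrite !mxE ffunE.
Qed.

Lemma compound_neq0 n j (A : 'M[R]_n) (S U : jsubset n j) : compound A S U != 0 ->
  exists s : 'S_j, forall a, A (jsubset_enum S a) (jsubset_enum U (s a)) != 0.
Proof.
move=> nz.
suff /existsP[s /forallP] : [exists s : 'S_j,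
    [forall a, A (jsubset_enum S a) (jsubset_enum U (s a)) != 0]] by exists s.
apply: contraNT nz => /existsPn sP; apply/eqP; apply: big1 => s _.
have /forallPn[a] := sP s; rewrite negbK => /eqP Aa.
by rewrite (bigD1 a) //= mxE Aa mul0r mulr0.
Qed.

Lemma compound1 n j (S U : jsubset n j) : compound (1%:M : 'M[R]_n) S U = (S == U)%:R.
Proof.
have [->|SU] := eqVneq S U.
  rewrite -[RHS](det1 R j); congr (\det _).
  by apply/matrixP => a b; rewrite !mxE (inj_eq (@jsubset_enum_inj _ _ U)).
apply/eqP; apply: contraNT SU => /compound_neq0 [s sP].
apply/eqP/jsubset_sub_eq/subsetP => x /jsubset_enum_onto [a <-].
have := sP a; rewrite mxE; case: (_ =P jsubset_enum U (s a)) => [-> _|_].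
  exact: jsubset_enumP.
by rewrite eqxx.
Qed.

Lemma compound_trig_diag n j (T : 'M[R]_n) (S : jsubset n j) : is_trig_mx T ->
  compound T S S = \prod_(x in val S) T x x.
Proof.
move=> /is_trig_mxP Ttrig; rewrite big_jsubset.
rewrite /compound /minor (det_weighted (w := fun a => jsubset_enum S a)).
  by apply: eq_bigr => a _; rewrite mxE.
move=> a b ab ab'; rewrite mxE Ttrig // ltn_neqAle ab' andbT.
by apply: contra ab => /eqP/val_inj/jsubset_enum_inj ->.
Qed.

(** A nonzero Leibniz term would pair each element of [S] with one of [U] that is no larger; the
    assumed order of the sums turns every such inequality into an equality. So the sum of the
    indices is a weight for [det_weighted]. *)
Lemma compound_trig_offdiag n j (T : 'M[R]_n) (S U : jsubset n j) :
  is_trig_mx T -> S != U -> (\sum_(x in val S) x <= \sum_(x in val U) x)%N ->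
  compound T S U = 0.
Proof.
move=> /is_trig_mxP Ttrig SU; rewrite !big_jsubset => SleU.
apply/eqP; apply: contraNT SU => /compound_neq0 [s sP].
have Us a : (jsubset_enum U (s a) <= jsubset_enum S a)%N.
  by rewrite leqNgt; apply: contra (sP a) => /Ttrig ->.
have : (\sum_a (jsubset_enum S a - jsubset_enum U (s a)))%N == 0%N.
  rewrite sumnB ?subn_eq0 => [|a _] //.
  by rewrite (leq_trans SleU) // [leqLHS](reindex_inj (@perm_inj _ s)).
rewrite sum_nat_eq0 => /forallP eqSU.
apply/eqP/jsubset_sub_eq/subsetP => x /jsubset_enum_onto [a <-].
suff -> : jsubset_enum S a = jsubset_enum U (s a) by apply: jsubset_enumP.
by apply/val_inj/eqP; rewrite eqn_leq Us andbT -subn_eq0; apply: (implyP (eqSU a)).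
Qed.

(** Indexing by ordinals makes matrix products and [char_poly] available for compounds. *)
Definition compound_mx n j (A : 'M[R]_n) : 'M[R]_#|{: jsubset n j}| :=
  \matrix_(a, b) compound A (enum_val a) (enum_val b).

Lemma compound_mxM n j (A B : 'M[R]_n) :
  compound_mx j (A *m B) = compound_mx j A *m compound_mx j B.
Proof.
apply/matrixP => a b; rewrite !mxE compoundM big_enum_val /=.
by apply: eq_bigr => c _; rewrite !mxE.
Qed.

Lemma compound_mx1 n j : compound_mx j (1%:M : 'M[R]_n) = 1%:M.
Proof.
by apply/matrixP => a b; rewrite !mxE compound1 (inj_eq enum_val_inj).
Qed.

Lemma char_poly_compound_trig n j (T : 'M[R]_n) : is_trig_mx T ->
  char_poly (compound_mx j T) =
    \prod_(S : jsubset n j) ('X - (\prod_(x in val S) T x x)%:P).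
Proof.
move=> Ttrig; rewrite big_enum_val /=.
pose w (a : 'I_#|{: jsubset n j}|) := (\sum_(x in val (enum_val a)) x)%N.
rewrite /char_poly (det_weighted (w := w)).
  by apply: eq_bigr => a _; rewrite !mxE eqxx compound_trig_diag.
move=> a b ab wab; rewrite !mxE (negPf ab) mulr0n sub0r.
by rewrite compound_trig_offdiag ?oppr0 // (inj_eq enum_val_inj).
Qed.

End CauchyBinet.

(** * Similarity, and the eigenvalues of compounds *)

Lemma char_poly_similar (F : fieldType) n (P A B : 'M[F]_n) :
  P \in unitmx -> P *m A = B *m P -> char_poly A = char_poly B.
Proof.
move=> Pu PA; pose PX := map_mx polyC P.
have PX0 : \det PX != 0 by rewrite det_map_mx polyC_eq0 -unitfE -unitmxE.
apply: (mulfI PX0); rewrite [RHS]mulrC /char_poly -!det_mulmx; congr (\det _).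
rewrite /char_poly_mx mulmxBr mulmxBl -!map_mxM PA.
by rewrite mul_mx_scalar mul_scalar_mx.
Qed.

Lemma trigonalization (C : numClosedFieldType) n (A : 'M[C]_n) :
  exists P T : 'M[C]_n, [/\ P \in unitmx, is_trig_mx T & P *m A = T *m P].
Proof.
case: n A => [|n] A.
  exists 1%:M, A; rewrite unitmx1 mul1mx mulmx1; split=> //.
  by apply/is_trig_mxP => -[].
have [P Pun /= Ptr] := Schur A (ltn0Sn n).
have Pu := unitarymx_unit Pun.
exists P, (conjmx P A); split=> //.
by rewrite conjumx // mulmxKV.
Qed.

(** One [lam], the diagonal of a triangular form, serves every [j]: compounds are multiplicative, so
    they carry the similarity along. *)
Lemma char_poly_compound (C : numClosedFieldType) n (A : 'M[C]_n) :
  exists lam : 'I_n -> C, char_poly A = \prod_i ('X - (lam i)%:P) /\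
    forall j, char_poly (compound_mx j A) =
      \prod_(S : jsubset n j) ('X - (\prod_(x in val S) lam x)%:P).
Proof.
have [P [T [Pu Ttr PA]]] := trigonalization A.
exists (fun i => T i i); split=> [|j].
  by rewrite (char_poly_similar Pu PA) char_poly_trig.
rewrite -char_poly_compound_trig //.
apply: (@char_poly_similar _ _ (compound_mx j P)).
  have /mulmx1_unit[] // : compound_mx j P *m compound_mx j (invmx P) = 1%:M.
  by rewrite -compound_mxM mulmxV // compound_mx1.
by rewrite -!compound_mxM PA.
Qed.

(** * Ordering eigenvalues through dominant products *)

Lemma card_ord_lt n j : (j <= n)%N -> #|[set i : 'I_n | (i < j)%N]| = j.
Proof.
move=> jn; have w_inj : injective (widen_ord jn).
  by move=> a b /(congr1 val) ab; apply: val_inj.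
rewrite -[RHS]card_ord -(card_imset _ w_inj).
apply: eq_card => i; rewrite inE; apply/idP/imsetP => [ij|[k _ ->]] /=; last first.
  exact: ltn_ord.
by exists (Ordinal ij) => //; apply: val_inj.
Qed.

Lemma sort_by_norm (C : numDomainType) n (lam : 'I_n -> C) :
  exists s : 'S_n, forall i k : 'I_n, (i < k)%N -> `|lam (s k)| <= `|lam (s i)|.
Proof.
pose geN := [rel i k : 'I_n | `|lam k| <= `|lam i|].
have geN_tr : transitive geN by move=> y x z /= xy yz; apply: le_trans xy.
have geN_tot : total geN by move=> x y; rewrite /= real_leVge ?normr_real.
have sz : size (sort geN (enum 'I_n)) == n by rewrite size_sort size_enum_ord.
pose t := Tuple sz.
have /tuple_uniqP t_inj : uniq t by rewrite sort_uniq enum_uniq.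
exists (perm t_inj) => i k ik; rewrite !permE !(tnth_nth i) /=.
apply: (sorted_ltn_nth geN_tr i (sort_sorted geN_tot _)) => //;
  by rewrite inE (eqP sz).
Qed.

Lemma dominant_products_order (C : numFieldType) n (lam : 'I_n -> C) :
  (forall j, (0 < j <= n)%N -> exists S0 : {set 'I_n},
    [/\ #|S0| = j, 0 < \prod_(x in S0) lam x & forall S : {set 'I_n},
        #|S| = j -> S != S0 -> `|\prod_(x in S) lam x| < \prod_(x in S0) lam x]) ->
  exists s : 'S_n, (forall i, 0 < lam (s i)) /\
    forall i k : 'I_n, (i < k)%N -> lam (s k) < lam (s i).
Proof.
move=> dom; have [s sP] := sort_by_norm lam; exists s.
pose T j := [set s i | i in [set i : 'I_n | (i < j)%N]].
have inT i j : (s i \in T j) = (i < j)%N by rewrite mem_imset ?inE //; apply: perm_inj.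
have cardT j : (j <= n)%N -> #|T j| = j.
  by move=> jn; rewrite card_imset ?card_ord_lt //; apply: perm_inj.
have top j : (0 < j <= n)%N -> 0 < \prod_(x in T j) lam x /\
    forall y x, y \notin T j -> x \in T j -> `|lam y| < `|lam x|.
  move=> /[dup] jn /dom [S0 [cS0 pos S0max]].
  (* Swap [x] for [y] in [S0] and cancel the common factors, which are nonzero because the dominant
     product is positive. *)
  have exch y x : y \notin S0 -> x \in S0 -> `|lam y| < `|lam x|.
    move=> yS xS; pose S := y |: (S0 :\ x).
    have yS' : y \notin S0 :\ x by rewrite !inE negb_and yS orbT.
    have cS : #|S| = j by rewrite cardsU1 yS' -cS0 [in RHS](cardsD1 x) xS.
    have neS : S != S0 by apply: contraNneq yS => <-; rewrite !inE eqxx.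
    have := S0max S cS neS; rewrite -[ltRHS](gtr0_norm pos).
    move: pos; rewrite big_setU1 //= (big_setD1 x xS) /= !normrM => pos.
    rewrite ltr_pM2r // normr_gt0; apply: contraTneq pos => ->.
    by rewrite mulr0 ltxx.
  suff -> : T j = S0 by [].
  have cT : #|T j| = j by apply: cardT; case/andP: jn.
  (* If the two sets of size [j] differ, some [y] of [T j] is outside [S0] and some [x] of [S0] is
     outside [T j]; sorting and [exch] then order their moduli in opposite ways. *)
  apply/eqP; rewrite eqEcard cT cS0 leqnn andbT; apply/negPn/negP => /subsetPn[y yT yS].
  have /subsetPn[x xS xT] : ~~ (S0 \subset T j).
    apply: contra yS => sST; suff -> : S0 = T j by [].
    by apply/eqP; rewrite eqEcard sST cT cS0 leqnn.
  have := exch y x yS xS; move: yT xT.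
  rewrite -(permKV s y) -(permKV s x) !inT -leqNgt => yj jx.
  by rewrite le_gtF ?sP // (leq_trans yj).
have pos j : (j <= n)%N -> 0 < \prod_(x in T j) lam x.
  case: j => [_|j jn]; last by have [] := top j.+1 jn.
  by rewrite big1 ?ltr01 // => x; rewrite -(permKV s x) inT.
(* [lam (s i)] is the quotient of the positive products over [T i.+1] and [T i]; the product over
   [T 0] is the empty one. *)
have lam_gt0 i : 0 < lam (s i).
  have := pos i.+1 (ltn_ord i).
  rewrite (big_setD1 (s i)) ?inT //= (_ : T i.+1 :\ s i = T i).
    by rewrite pmulr_lgt0 // pos // ltnW.
  apply/setP => x; rewrite -(permKV s x) in_setD1 !inT (inj_eq perm_inj).
  by rewrite ltnS ltn_neqAle.
split=> // i k ik; rewrite -[ltLHS]gtr0_norm // -[ltRHS]gtr0_norm //.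
by have [_] := top i.+1 (ltn_ord i); apply; rewrite inT ?ltnS // -ltnNge.
Qed.

(** * Perron's theorem for sign-symmetric matrices and compounds *)

Lemma ltc0R (R : rcfType) (x : R) : (0 < x%:C%C) = (0 < x).
Proof. by rewrite -ltcR. Qed.

Lemma deriv_double_root (R : comNzRingType) (q : {poly R}) a :
  (('X - a%:P) * (('X - a%:P) * q))^`().[a] = 0.
Proof.
rewrite derivM hornerD !hornerM hornerXsubC subrr.
by rewrite mul0r mulr0 mul0r addr0.
Qed.

Section SignSymmetric.
Variable R : rcfType.
Local Notation toC := (real_complex R).

Lemma perron_sign_symmetric m (M : 'M[R]_m) (e : 'I_m -> bool) : (0 < m)%N ->
  (forall i k, if e i == e k then 0 < M i k else M i k < 0) ->
  exists r, [/\ 0 < r, (char_poly M).[r] = 0, (char_poly M)^`().[r] != 0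
    & forall mu, root (map_poly toC (char_poly M)) mu -> mu != r%:C%C -> `|mu| < r%:C%C].
Proof.
case: m M e => // m M e _ Me.
(* The diagonal sign matrix is its own inverse, so [B] is similar to [M]. *)
pose d : 'rV[R]_m.+1 := \row_i (-1) ^+ e i.
pose B := \matrix_(i, k) ((-1) ^+ e i * M i k * (-1) ^+ e k).
have Bpos i k : 0 < B i k.
  rewrite mxE mulrAC -signr_addb; have := Me i k.
  by case: (e i); case: (e k); rewrite /= ?expr0 ?expr1 ?mul1r // mulN1r oppr_gt0.
have -> : char_poly M = char_poly B.
  apply: (@char_poly_similar _ _ (diag_mx d)).
    rewrite unitmxE det_diag unitfE prodf_seq_neq0; apply/allP => i _ /=.
    by rewrite mxE signr_eq0.
  rewrite mul_diag_mx mul_mx_diag; apply/matrixP => i k; rewrite !mxE.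
  by rewrite -!mulrA -expr2 sqrr_sign mulr1.
have [r [v [r0 pr dpr vpos Bv]]] := perron_root Bpos.
exists r; split=> // mu; rewrite map_char_poly.
apply: (@perron_dominance _ _ _ (map_mx toC v)).
- by move=> i k; rewrite mxE ltc0R.
- by rewrite ltc0R.
- by move=> i; rewrite mxE ltc0R.
- by rewrite -map_mxM Bv map_mxZ.
Qed.

(** Order [1] comes from the condition on [A] itself, carried over to singletons. *)
Lemma STJS_compound n (A : 'M[R]_n) j : STJS A -> (0 < j <= n)%N ->
  strictly_sign_symmetric (@compound R n j A).
Proof.
move=> [[J AJ] Aj]; case: j => [//|[|j]] jn; last exact: Aj.
exists [set S : jsubset n 1 | jsubset_enum S ord0 \in J] => S U.
by rewrite !inE /compound /minor det_mx11 mxE; apply: AJ.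
Qed.

(** [S0] is a subset whose product is the Perron root. A second such subset would make that root
    double, against the nonvanishing derivative. *)
Lemma compound_dominant_product n (A : 'M[R]_n) (lam : 'I_n -> R[i]) j :
  strictly_sign_symmetric (@compound R n j A) -> (j <= n)%N ->
  char_poly (compound_mx j (map_mx toC A)) =
    \prod_(S : jsubset n j) ('X - (\prod_(x in val S) lam x)%:P) ->
  exists S0 : {set 'I_n}, [/\ #|S0| = j, 0 < \prod_(x in S0) lam x &
    forall S : {set 'I_n}, #|S| = j -> S != S0 ->
      `|\prod_(x in S) lam x| < \prod_(x in S0) lam x].
Proof.
move=> [J AJ] jn.
have -> : compound_mx j (map_mx toC A) = map_mx toC (compound_mx j A).
  apply/matrixP => a b; rewrite !mxE -det_map_mx; congr (\det _).
  by apply/matrixP => c d; rewrite !mxE.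
pose T := [set i : 'I_n | (i < j)%N].
have cardT : #|T| == j by rewrite card_ord_lt.
have card_gt0 : (0 < #|{: jsubset n j}|)%N by apply/card_gt0P; exists (Sub T cardT).
have [|r [r0 pr dpr mu_lt]] :=
    @perron_sign_symmetric _ (compound_mx j A) (fun a => enum_val a \in J) card_gt0.
  by move=> a b; rewrite mxE; apply: AJ.
rewrite -map_char_poly => pE.
have rootE' mu : root (map_poly toC (char_poly (compound_mx j A))) mu =
    [exists S : jsubset n j, mu == \prod_(x in val S) lam x].
  rewrite pE rootE horner_prod prodf_seq_eq0; apply/hasP/existsP => -[S].
    by rewrite !hornerE subr_eq0; exists S.
  by move=> SP; exists S; rewrite ?mem_index_enum //= !hornerE subr_eq0.
have /existsP[S0 /eqP rS0] : [exists S : jsubset n j, r%:C%C == \prod_(x in val S) lam x].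
  by rewrite -rootE' rootE horner_map /= pr.
exists (val S0); rewrite -rS0 ltc0R (eqP (valP S0)); split=> // S /eqP cS SS0.
pose S1 : jsubset n j := Sub S cS.
apply: mu_lt; first by rewrite rootE'; apply/existsP; exists S1.
apply: contra dpr => /eqP rS.
have /(congr1 (fun p => p^`().[r%:C%C])) := pE.
rewrite (bigD1 S0) //= (bigD1 S1) //= -rS0 rS.
by rewrite deriv_double_root deriv_map horner_map => /eqP; rewrite fmorph_eq0.
Qed.

End SignSymmetric.

Theorem theorem31 (R : realType) (n : nat) (A : 'M[R]_n) :
  STJS A ->
  exists lam : 'I_n -> R,
    (forall i k : 'I_n, (i < k)%N -> lam k < lam i) /\
    (forall i : 'I_n, 0 < lam i) /\
    char_poly A = \prod_(i < n) ('X - (lam i)%:P).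
Proof.
move=> STA.
have [lam [pA pc]] := char_poly_compound (map_mx (real_complex R) A).
have [s [s0 slt]] : exists s : 'S_n, (forall i, 0 < lam (s i)) /\
    forall i k : 'I_n, (i < k)%N -> lam (s k) < lam (s i).
  apply: dominant_products_order => j jn.
  apply: (@compound_dominant_product _ _ A) => //; first exact: STJS_compound.
  by case/andP: jn.
(* In the order on complex numbers a positive number is real, so it equals its real part. *)
have lamRe i : (complex.Re (lam (s i)))%:C%C = lam (s i).
  by rewrite RRe_real // gtr0_real.
exists (fun i => complex.Re (lam (s i))); split; last split.
- by move=> i k ik; rewrite -ltcR !lamRe slt.
- by move=> i; rewrite -ltc0R lamRe.
(* The factorization descends to [R] because the embedding of coefficients is injective. *)
apply: (map_poly_inj (real_complex R)); rewrite map_char_poly pA rmorph_prod.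
rewrite (reindex_inj (@perm_inj _ s)); apply: eq_bigr => i _.
by rewrite /= map_polyXsubC -[in LHS]lamRe.
Qed.
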